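(* Let $L \ge 0$, $E \in \Psi_L$, and let $R \in \Gamma_0$ have locally bounded subgradients. Suppose that the surrogate function $F$ is a KL function. Suppose that, for some $\rho_1 > 0$, the stepsizes satisfy $0 < \tau^k \leq \frac{2}{L + 2\rho_1}$ for all $k$, and that $\inf_k \tau^k > 0$. Let $\{(u^k,q^k)\}_{k\ge0}$ be generated by the specialised linearised Bregman iteration from $u^0$ and $q^0 \in \partial R(u^0)$. Then the sequence $\{u^k\}_{k}$ converges to a critical point of $E$, i.e. to a point $\overline{u}\in\mathbb{R}^n$ with $\nabla E(\overline{u})=0$.
   Context: $\|\cdot\|$ is the Euclidean norm. $\Gamma_0$ is the set of proper, lower semi-continuous, convex functions $\mathbb{R}^n \to \mathbb{R}\cup\{\infty\}$. $\Psi_L$ is the set of continuously differentiable functions $E:\mathbb{R}^n\to\mathbb{R}$ (not necessarily convex) whose gradient is Lipschitz continuous with constant $L$, that have bounded level sets, and that are bounded from below. $\partial R$ is the convex subdifferential and $R^\ast(p) := \sup_{u}\{\langle u,p\rangle - R(u)\}$ is the convex conjugate. $R$ has locally bounded subgradients if for every compact set $U\subset\mathbb{R}^n$ there exists a constant $C\in(0,\infty)$ such that for all $v\in U$ and all $q\in\partial R(v)$ we have $\|q\|\le C$. Specialised linearised Bregman iteration: given positive stepsizes $\{\tau^k\}_{k\ge 0}$, $u^0$ and $q^0 \in \partial R(u^0)$, for $k = 0,1,\dots$ set $$u^{k+1} = (I+\tau^k \partial R)^{-1}\left(u^k + \tau^k(q^k - \nabla E(u^k))\right), \qquad q^{k+1}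 = q^k - \frac{1}{\tau^k}\left(u^{k+1} - u^k + \tau^k \nabla E(u^k)\right),$$ where $(I+\tau\partial R)^{-1}(f) := \arg\min_{u}\{\frac12\|u-f\|^2 + \tau R(u)\}$. One has $q^{k}\in\partial R(u^{k})$ for all $k$. Surrogate function: $F:\mathbb{R}^n\times\mathbb{R}^n \to \mathbb{R}\cup\{\infty\}$, $F(x,y) := E(x) + R(x) + R^\ast(y) - \langle x,y\rangle$, with subdifferential $$\partial F(x,y) = \left\{ \begin{pmatrix} \nabla E(x) + z_1 - y \\ z_2 - x\end{pmatrix} : z_1 \in \partial R(x),\ z_2 \in \partial R^\ast(y)\right\}.$$ KL property: for a set $\Omega$, $\operatorname{dist}(w,\Omega):=\inf\{\|v-w\| : v\in\Omega\}$ if $\Omega\ne\emptyset$ and $\infty$ otherwise. A function $J$ on $\mathbb{R}^N$ has the Kurdyka-Łojasiewicz (KL) property at $\overline{w}\in\operatorname{dom}(\partial J):=\{w : \partial J(w)\neq\emptyset\}$ if there exist $\eta\in(0,\infty]$, a neighbourhood $\Theta$ of $\overline{w}$ and a concave function $\varphi:[0,\eta)\to[0,\infty)$ that is continuous at $0$ with $\varphi(0)=0$, $\varphi\in C^1((0,\eta))$ and $\varphi'(s)>0$ for all $s\in(0,\eta)$, such that for all $w\in\Theta$ with $J(\overline{w})<J(w)<J(\overline{w})+\eta$, $$\varphi'\left(J(w)-J(\overline{w})\right)\operatorname{dist}(0,\partial J(w))\ge 1 .$$ $J$ is a KL function if it has the KL property at each point of $\operatorname{dom}(\partial J)$. Here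 this is applied to $J=F$ on $\mathbb{R}^n\times\mathbb{R}^n$. *)

(* Defs.v *)
From HB Require Import structures.
From mathcomp Require Import all_boot all_order all_algebra.
From mathcomp Require Import all_classical all_reals all_analysis.
Import Order.TTheory GRing.Theory Num.Theory.
Import numFieldNormedType.Exports.

Set Implicit Arguments.
Unset Strict Implicit.
Unset Printing Implicit Defensive.

Local Open Scope classical_set_scope.
Local Open Scope ring_scope.

(* R^n is 'rV[K]_n with K : realType. The canonical norm of 'rV[K]_n in the
   library is the sup norm, hence the explicit Euclidean norm below; topological
   notions (limits, compactness, boundedness) are those of the library and do
   not depend on this choice. *)
Definition dotp (K : realType) (n : nat) (x y : 'rV[K]_n) : K :=
  \sum_(i < n) x ord0 i * y ord0 i.

Definition enorm (K : realType) (n : nat) (x : 'rV[K]_n) : K :=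
  Num.sqrt (dotp x x).

Definition gradient (K : realType) (n : nat) (E : 'rV[K]_n -> K)
    (x : 'rV[K]_n) : 'rV[K]_n :=
  \row_(i < n) 'D_(delta_mx ord0 i) E x.

Record Psi (K : realType) (n : nat) (L : K) (E : 'rV[K]_n -> K) : Prop := {
  Psi_differentiable : forall x, differentiable E x;
  Psi_continuous_gradient : continuous (gradient E);
  Psi_lipschitz_gradient : forall x y,
    enorm (gradient E x - gradient E y) <= L * enorm (x - y);
  Psi_bounded_level_sets : forall a, bounded_set [set x | E x <= a];
  Psi_bounded_below : exists m, forall x, m <= E x }.

Definition proper (K : realType) (n : nat) (R : 'rV[K]_n -> \bar K) : Prop :=
  (forall x, -oo < R x)%E /\ (exists x, R x < +oo)%E.

(* In \bar K, 0 * +oo = 0, so for a proper R the cases t = 0 and t = 1 hold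
   trivially. *)
Definition convex_efun (K : realType) (n : nat) (R : 'rV[K]_n -> \bar K) :=
  forall (x y : 'rV[K]_n) (t : K), 0 <= t <= 1 ->
    (R (t *: x + (1 - t) *: y)%R <= t%:E * R x + (1 - t)%:E * R y)%E.

Record Gamma0 (K : realType) (n : nat) (R : 'rV[K]_n -> \bar K) : Prop := {
  Gamma0_proper : proper R;
  Gamma0_lsc : lower_semicontinuous R;
  Gamma0_convex : convex_efun R }.

(* For a proper R this is empty at every x with R x = +oo. *)
Definition subdiff (K : realType) (n : nat) (R : 'rV[K]_n -> \bar K)
    (x : 'rV[K]_n) : set 'rV[K]_n :=
  [set q | forall y, (R x + (dotp q (y - x)%R)%:E <= R y)%E].

Definition conjugate (K : realType) (n : nat) (R : 'rV[K]_n -> \bar K)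
    (p : 'rV[K]_n) : \bar K :=
  ereal_sup [set ((dotp u p)%:E - R u)%E | u in [set: 'rV[K]_n]].

Definition locally_bounded_subgradients (K : realType) (n : nat)
    (R : 'rV[K]_n -> \bar K) : Prop :=
  forall U : set 'rV[K]_n, compact U ->
    exists C : K, 0 < C /\
      forall v q, U v -> subdiff R v q -> enorm q <= C.

Definition argmin (K : realType) (T : Type) (f : T -> \bar K) : set T :=
  [set u | forall v, (f u <= f v)%E].

(* (I + tau dR)^-1 f as a set of minimisers. *)
Definition resolvent (K : realType) (n : nat) (R : 'rV[K]_n -> \bar K)
    (tau : K) (f : 'rV[K]_n) : set 'rV[K]_n :=
  argmin (fun u => ((2^-1 * enorm (u - f) ^+ 2)%:E + tau%:E * R u)%E).

Record linearised_bregman (K : realType) (n : nat) (E : 'rV[K]_n -> K)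
    (R : 'rV[K]_n -> \bar K) (tau : nat -> K) (u q : nat -> 'rV[K]_n) : Prop := {
  bregman_init : subdiff R (u 0%N) (q 0%N);
  bregman_u : forall k, resolvent R (tau k)
    (u k + tau k *: (q k - gradient E (u k))) (u k.+1);
  bregman_q : forall k, q k.+1 =
    q k - (tau k)^-1 *: (u k.+1 - u k + tau k *: gradient E (u k)) }.

(* The surrogate function lives on R^n x R^n, encoded as 'rV[K]_(n + n), so
   that the Euclidean norm on the product is again enorm. *)
Definition surrogate (K : realType) (n : nat) (E : 'rV[K]_n -> K)
    (R : 'rV[K]_n -> \bar K) (w : 'rV[K]_(n + n)) : \bar K :=
  let x := lsubmx w in let y := rsubmx w in
  ((E x)%:E + R x + conjugate R y - (dotp x y)%:E)%E.

Definition surrogate_subdiff (K : realType) (n : nat) (E : 'rV[K]_n -> K)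
    (R : 'rV[K]_n -> \bar K) (w : 'rV[K]_(n + n)) : set 'rV[K]_(n + n) :=
  let x := lsubmx w in let y := rsubmx w in
  [set row_mx (gradient E x + z1 - y) (z2 - x)
     | z1 in subdiff R x & z2 in subdiff (conjugate R) y].

(* ereal_inf set0 = +oo. *)
Definition edist (K : realType) (N : nat) (w : 'rV[K]_N) (Omega : set 'rV[K]_N)
    : \bar K :=
  ereal_inf [set (enorm (v - w))%:E | v in Omega].

(* phi : [0, eta) -> [0, oo) is represented by a total function constrained
   only on [0, eta); continuity at 0 is therefore continuity from the right. *)
Record desingularising (K : realType) (eta : \bar K) (phi : K -> K) : Prop := {
  desing_ge0 : forall s : K, 0 <= s -> (s%:E < eta)%E -> 0 <= phi s;
  desing_concave : forall s t l : K,
    0 <= s -> (s%:E < eta)%E -> 0 <= t -> (t%:E < eta)%E -> 0 <= l <= 1 ->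
    l * phi s + (1 - l) * phi t <= phi (l * s + (1 - l) * t);
  desing0 : phi 0 = 0;
  desing_continuous0 : phi s @[s --> 0^'+] --> phi 0;
  desing_derivable : forall s : K, 0 < s -> (s%:E < eta)%E -> derivable phi s 1;
  desing_continuous_derive : forall s : K, 0 < s -> (s%:E < eta)%E ->
    {for s, continuous (derive1 phi)};
  desing_derive_gt0 : forall s : K, 0 < s -> (s%:E < eta)%E -> 0 < derive1 phi s }.

(* dJ is the subdifferential of J : R^N -> R \cup {oo}. Where the inequality is
   required, J w - J w0 is finite, so that fine is harmless. *)
Definition KL_property (K : realType) (N : nat) (J : 'rV[K]_N -> \bar K)
    (dJ : 'rV[K]_N -> set 'rV[K]_N) (w0 : 'rV[K]_N) : Prop :=
  exists (eta : \bar K) (Theta : set 'rV[K]_N) (phi : K -> K),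
    [/\ (0 < eta)%E, nbhs w0 Theta, desingularising eta phi &
     forall w, Theta w -> (J w0 < J w)%E -> (J w < J w0 + eta)%E ->
       (1%:E <= (derive1 phi (fine (J w - J w0)))%:E * edist 0%R (dJ w))%E].

Definition KL_function (K : realType) (N : nat) (J : 'rV[K]_N -> \bar K)
    (dJ : 'rV[K]_N -> set 'rV[K]_N) : Prop :=
  forall w0, dJ w0 !=set0 -> KL_property J dJ w0.

(* Main.v *)
(* Along the iteration the surrogate values
     F(u^{k+1}, q^k) = E(u^{k+1}) + D_R(u^{k+1}, u^k)
   lie between E(u^{k+1}) and E(u^k), drop by at least rho1 |u^{k+1} - u^k|^2
   from E(u^k), and dF contains at (u^{k+1}, q^k) an element of norm
   O(|u^{k+1} - u^k|).  The increments of q^k are not controlled, so the pairs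
   (u^{k+1}, q^k) may drift between limit points; since F takes the value
   lim E(u^k) at every limit point, compactness allows the finitely many
   desingularising functions involved to be added up.  The usual KL argument
   then gives sum_k |u^{k+1} - u^k| < oo.  Finally q^{k+1} - q^k converges to
   - grad E(ubar), and boundedness of q^k forces this limit to vanish. *)

Require Import Defs.
From HB Require Import structures.
From mathcomp Require Import all_boot all_order all_algebra.
From mathcomp Require Import all_classical all_reals all_analysis.
From mathcomp Require Import ring lra.
Import Order.TTheory GRing.Theory Num.Theory.
Import numFieldNormedType.Exports.
Local Open Scope classical_set_scope.
Local Open Scope ring_scope.

Set Implicit Arguments.
Unset Strict Implicit.
Unset Printing Implicit Defensive.

(** * Euclidean norm and inner product; coordinatewise limits *)

Section EuclideanNorm.
Context {K : realType} {n : nat}.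
Implicit Types x y z : 'rV[K]_n.

Lemma dotpC x y : dotp x y = dotp y x.
Proof. by apply: eq_bigr => i _; rewrite mulrC. Qed.

Lemma dotpDl x y z : dotp (x + y) z = dotp x z + dotp y z.
Proof. by rewrite -big_split; apply: eq_bigr => i _; rewrite mxE mulrDl. Qed.

Lemma dotpZl (a : K) x y : dotp (a *: x) y = a * dotp x y.
Proof. by rewrite mulr_sumr; apply: eq_bigr => i _; rewrite mxE mulrA. Qed.

Lemma dotpDr x y z : dotp x (y + z) = dotp x y + dotp x z.
Proof. by rewrite !(dotpC x) dotpDl. Qed.

Lemma dotpZr (a : K) x y : dotp x (a *: y) = a * dotp x y.
Proof. by rewrite !(dotpC x) dotpZl. Qed.

Lemma dotpNl x y : dotp (- x) y = - dotp x y.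
Proof. by rewrite -scaleN1r dotpZl mulN1r. Qed.

Lemma dotpNr x y : dotp x (- y) = - dotp x y.
Proof. by rewrite !(dotpC x) dotpNl. Qed.

Definition dotpE := (dotpDl, dotpDr, dotpNl, dotpNr, dotpZl, dotpZr).

Lemma dotp_ge0 x : 0 <= dotp x x.
Proof. by apply: sumr_ge0 => i _; rewrite -expr2 sqr_ge0. Qed.

Lemma enorm_ge0 x : 0 <= enorm x.
Proof. exact: sqrtr_ge0. Qed.

Lemma sqr_enorm x : enorm x ^+ 2 = dotp x x.
Proof. by rewrite sqr_sqrtr // dotp_ge0. Qed.

Lemma enormN x : enorm (- x) = enorm x.
Proof. by rewrite /enorm dotpNl dotpNr opprK. Qed.

Lemma enormZ (a : K) x : enorm (a *: x) = `|a| * enorm x.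
Proof.
by rewrite /enorm dotpZl dotpZr mulrA -expr2 sqrtrM ?sqr_ge0 // sqrtr_sqr.
Qed.

Lemma enorm_coord x i : `|x ord0 i| <= enorm x.
Proof.
rewrite -ler_sqr ?nnegrE ?enorm_ge0 // sqr_enorm real_normK ?num_real //.
rewrite /dotp (bigD1 i) //= -expr2 lerDl.
by apply: sumr_ge0 => j _; rewrite -expr2 sqr_ge0.
Qed.

(** Carries Euclidean estimates over to the topology of the library, which is defined by the sup
    norm. *)
Lemma normr_le_enorm x : `|x| <= enorm x.
Proof.
rewrite [leLHS]/Num.norm /= mx_normrE; apply/bigmax_leP.
by split=> [|[i j] _]; rewrite ?enorm_ge0 //= (ord1 i) enorm_coord.
Qed.

Lemma enorm_eq0 x : enorm x = 0 -> x = 0.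
Proof. by move=> x0; apply/normr0_eq0/le_anti; rewrite -{1}x0 normr_le_enorm /=. Qed.

(** Cauchy-Schwarz: for nonzero vectors, expand the square of [enorm y *: x - enorm x *: y] and
    divide by [enorm x * enorm y]. *)
Lemma dotp_le_enorm x y : dotp x y <= enorm x * enorm y.
Proof.
have [/enorm_eq0 ->|x0] := eqVneq (enorm x) 0.
  by rewrite -(scale0r y) dotpZl enormZ mul0r normr0 !mul0r.
have [/enorm_eq0 ->|y0] := eqVneq (enorm y) 0.
  by rewrite -(scale0r x) dotpZr enormZ mul0r normr0 !mul0r mulr0.
have ab0 : 0 < enorm x * enorm y by rewrite mulr_gt0 // lt0r ?x0 ?y0 enorm_ge0.
have := dotp_ge0 (enorm y *: x - enorm x *: y).
rewrite !dotpE -!sqr_enorm (dotpC y x) => h.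
suff: 0 <= (enorm x * enorm y) * (enorm x * enorm y - dotp x y).
  by rewrite pmulr_rge0 // subr_ge0.
nra.
Qed.

Lemma enormD x y : enorm (x + y) <= enorm x + enorm y.
Proof.
rewrite -ler_sqr ?nnegrE ?addr_ge0 ?enorm_ge0 // sqr_enorm !dotpE -!sqr_enorm.
by have := dotp_le_enorm x y; rewrite (dotpC y x); nra.
Qed.

Lemma enormB x y : enorm (x - y) <= enorm x + enorm y.
Proof. by rewrite (le_trans (enormD _ _)) // enormN. Qed.

Lemma cvg_rV (T : Type) (F : set_system T) {FF : Filter F} (f : T -> 'rV[K]_n)
    (l : 'rV[K]_n) :
  (forall i, f t ord0 i @[t --> F] --> l ord0 i) -> f t @[t --> F] --> l.
Proof.
move=> fl; apply/cvgrPdist_le => e e0; near=> t.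
rewrite [leLHS]/Num.norm /= mx_normrE (bigmax_le _ (ltW e0)) // => -[i j] _.
rewrite (ord1 i) /= !mxE; move: j.
near: t; apply: filter_forall => j.
by have /cvgrPdist_le/(_ _ e0) := fl j.
Unshelve. all: by end_near. Qed.

Lemma cvg_coord (T : Type) (F : set_system T) {FF : Filter F}
    (f : T -> 'rV[K]_n) (l : 'rV[K]_n) i :
  f t @[t --> F] --> l -> f t ord0 i @[t --> F] --> l ord0 i.
Proof.
move=> fl; apply: (@cvg_comp _ _ _ f (fun x : 'rV[K]_n => x ord0 i) F (nbhs l) _ fl).
exact: coord_continuous.
Qed.

Lemma cvg_dotp (T : Type) (F : set_system T) {FF : Filter F}
    (f g : T -> 'rV[K]_n) (a b : 'rV[K]_n) :
  f t @[t --> F] --> a -> g t @[t --> F] --> b ->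
  dotp (f t) (g t) @[t --> F] --> dotp a b.
Proof.
by move=> fa gb; apply: cvg_big => [|i _]; [exact: add_continuous|
  apply: cvgM; exact: cvg_coord].
Qed.

End EuclideanNorm.

Lemma enorm_row_mx (K : realType) (n1 n2 : nat) (x : 'rV[K]_n1) (y : 'rV[K]_n2) :
  enorm (row_mx x y) <= enorm x + enorm y.
Proof.
rewrite -ler_sqr ?nnegrE ?addr_ge0 ?enorm_ge0 // sqr_enorm.
rewrite /dotp big_split_ord /=.
under eq_bigr do rewrite row_mxEl.
under [X in _ + X <= _]eq_bigr do rewrite row_mxEr.
by rewrite -!/(dotp _ _) -!sqr_enorm; have := enorm_ge0 x; have := enorm_ge0 y; nra.
Qed.

(** * Gradients and the descent lemma *)

Section Descent.
Context {K : realType} {n : nat}.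
Variable E : 'rV[K]_n -> K.
Implicit Types x d : 'rV[K]_n.

Lemma derive_gradient x d :
  differentiable E x -> 'D_d E x = dotp (gradient E x) d.
Proof.
move=> Ex; rewrite deriveE // {1}(row_sum_delta d) linear_sum.
by apply: eq_bigr => i _; rewrite linearZ /= mxE deriveE // mulrC.
Qed.

Lemma is_derive_line x d (t : K) : differentiable E (x + t *: d) ->
  is_derive t 1 (fun s : K => E (x + s *: d)) (dotp (gradient E (x + t *: d)) d).
Proof.
move=> Et; rewrite -derive_gradient //.
(* Regrouped, the difference quotient of the restriction to the line is that of the directional
   derivative. *)
have shiftE : (fun h : K => h^-1 *: (E (x + (h *: 1 + t) *: d) - E (x + t *: d))) =
    (fun h : K => h^-1 *: (E (h *: d + (x + t *: d)) - E (x + t *: d))).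
  by apply/funext => h; rewrite scalerDl addrCA [h *: 1]mulr1.
have : derivable E (x + t *: d) d by exact: diff_derivable.
rewrite /derivable => cE.
by apply: DeriveDef; rewrite /derivable /derive /= shiftE.
Qed.

(** The function [g] is [E] along the segment minus its linear part and the quadratic bound. By
    Cauchy-Schwarz and the Lipschitz bound [g'] is nonpositive on [0, 1], so the mean value theorem
    gives [g 1 <= g 0]. *)
Lemma descent L x y : (forall x, differentiable E x) ->
  (forall x y, enorm (gradient E x - gradient E y) <= L * enorm (x - y)) ->
  E y <= E x + dotp (gradient E x) (y - x) + L / 2 * enorm (y - x) ^+ 2.
Proof.
move=> dE lipE; set d := y - x; set c := dotp (gradient E x) d.
pose g (t : K) := E (x + t *: d) - (t * c + L / 2 * enorm d ^+ 2 * t ^+ 2).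
pose g' t := dotp (gradient E (x + t *: d)) d - (c + L * enorm d ^+ 2 * t).
have gD (t : K) : is_derive t 1 g (g' t).
  have Ed := @is_derive_line x d t (dE _).
  apply: is_derive_eq.
  by rewrite /g' /GRing.scale /=; field.
have cg : {within `[0, 1], continuous g}.
  by apply: continuous_subspaceT => t; apply: differentiable_continuous;
     apply/derivable1_diffP; exact: ex_derive.
have [t t01 gE] := MVT_segment ler01 (fun t _ => gD t) cg.
suff: g' t <= 0.
  by move: gE; rewrite /g scale1r scale0r addr0 subr0 mulr1 {1}/d [x + _]addrC subrK; lra.
have t0 : 0 <= t by move: t01; rewrite in_itv => /andP[].
rewrite /g' /c subr_le0 -lerBlDl -dotpNl -dotpDl.
apply: (le_trans (dotp_le_enorm _ _)).
rewrite expr2 mulrA mulrAC -!mulrA [enorm d * (_ * _)]mulrC mulrA.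
apply: ler_wpM2r; first exact: enorm_ge0.
by apply: (le_trans (lipE _ _)); rewrite addrC addKr enormZ ger0_norm.
Qed.

End Descent.

(** * Auxiliary facts on compactness, concavity and sequences *)

(** If [P A] failed, the sets [V] with [P (A \ V)] would form a proper filter containing [A]. At a
    cluster point in [A], the complement of a neighbourhood satisfying [P] belongs to this filter, a
    contradiction. *)
Lemma compact_induction (T : topologicalType) (A : set T) (P : set T -> Prop) :
  compact A -> P set0 -> (forall U V, U `<=` V -> P V -> P U) ->
  (forall U V, P U -> P V -> P (U `|` V)) ->
  (forall x, A x -> exists2 V, nbhs x V & P V) -> P A.
Proof.
move=> cA P0 Psub PU Ploc; apply: contrapT => nPA.
pose F := [set V | P (A `\` V)].
have FF : ProperFilter F.
  split; first by rewrite /F /= setD0.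
  split; first by rewrite /F /= setDT.
    by move=> U V FU FV; rewrite /F /= setDIr; exact: PU.
  by move=> U V UV; apply: Psub; exact: setDS.
have FA : F A by rewrite /F /= setDv.
have [x [Ax clx]] := cA F FF FA.
have [V xV PV] := Ploc x Ax.
have FV : F (~` V) by apply: Psub PV => y [_] /contrapT.
by have [y [nVy Vy]] := clx _ _ FV xV.
Qed.

(** The derivative at [a] is the limit of difference quotients from the left, each at most the chord
    slope between [b] and [a]. The case [b = 0], where [phi] need not be differentiable, is thus
    included. *)
Lemma concave_tangent (K : realType) (eta : \bar K) (phi : K -> K) (a b : K) :
  desingularising eta phi -> 0 <= b -> b <= a -> 0 < a -> (a%:E < eta)%E ->
  derive1 phi a * (a - b) <= phi a - phi b.
Proof.
move=> D b0; rewrite le_eqVlt => /predU1P[->|ba] a0 aeta.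
  by rewrite !subrr mulr0.
have ab0 : 0 < a - b by rewrite subr_gt0.
have beta : (b%:E < eta)%E by apply: lt_trans aeta; rewrite lte_fin.
rewrite -ler_pdivlMr // derive1E.
have cvg_left := cvg_dnbhs_at_left (desing_derivable D a0 aeta).
apply: (cvgr_to_le cvg_left); near=> h.
have h0 : h < 0 by near: h; exact: nbhs_left_lt.
have hab : b - a < h by near: h; apply: nbhs_left_gt; rewrite subr_lt0.
rewrite -[h *: 1]/(h * 1) mulr1 -[_ *: _]/(_ * _).
set l := - h / (a - b).
have l01 : 0 <= l <= 1.
  by rewrite /l divr_ge0 ?ler_pdivrMr ?(ltW ab0) //; lra.
have hE : h + a = l * b + (1 - l) * a by rewrite /l; field; lra.
have := desing_concave D b0 beta (ltW a0) aeta l01.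
rewrite -hE ler_ndivrMl //= => hh.
rewrite (_ : h * _ = - l * (phi a - phi b)); first lra.
by rewrite /l; field; lra.
Unshelve. all: by end_near. Qed.

(** Half of each term is absorbed by its predecessor, and the differences of [Phi] telescope. *)
Lemma summable_of_recursion (K : realFieldType) (d Phi : nat -> K) (c : K) N :
  (forall k, 0 <= d k) -> (forall k, (N <= k)%N -> 0 <= Phi k) -> 0 <= c ->
  (forall k, (N <= k)%N -> d k.+1 <= d k / 2 + c * (Phi k - Phi k.+1)) ->
  exists M, forall m, \sum_(0 <= k < m) d k <= M.
Proof.
move=> d0 Phi0 c0 rec.
pose B := 2 * (d N + c * Phi N).
(* The weight 2 makes this an invariant: twice the recursion pays exactly for the new summand. *)
have tail m : \sum_(N <= k < N + m) d k + 2 * (d (N + m)%N + c * Phi (N + m)%N) <= B.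
  elim: m => [|m IH]; first by rewrite addn0 big_geq // add0r.
  rewrite addnS big_nat_recr ?leq_addr //=.
  by have := rec (N + m)%N (leq_addr _ _); lra.
exists (\sum_(0 <= k < N) d k + B) => m.
(* Since [m] may be smaller than [N], the sum is first extended to [N + m] nonnegative terms. *)
apply: (@le_trans _ _ (\sum_(0 <= k < N + m) d k)).
  rewrite [leRHS](big_cat_nat (n := m)) ?leq_addl //= lerDl.
  by apply: sumr_ge0.
rewrite [leLHS](big_cat_nat (n := N)) ?leq_addr //= lerD2l.
have := tail m; have := d0 (N + m)%N.
by have := mulr_ge0 c0 (Phi0 (N + m)%N (leq_addr _ _)); lra.
Qed.

(** In each coordinate the telescoping series converges absolutely. *)
Lemma cvg_finite_length (K : realType) (n : nat) (u : nat -> 'rV[K]_n) (M : K) :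
  (forall m, \sum_(0 <= k < m) enorm (u k.+1 - u k) <= M) ->
  exists l : 'rV[K]_n, u k @[k --> \oo] --> l.
Proof.
move=> uM.
have cu i : cvgn (fun k => u k ord0 i).
  have : cvgn (series (telescope (fun k => u k ord0 i))).
    apply: normed_cvg; apply: nondecreasing_is_cvgn.
      by apply: nondecreasing_series => k _ _; exact: normr_ge0.
    exists M => _ [m _ <-]; apply: le_trans (uM m); apply: ler_sum => k _.
    by rewrite /telescope; have := enorm_coord (u k.+1 - u k) i; rewrite !mxE.
  move=> /cvg_ex[l sl]; apply/cvg_ex; exists (u 0%N ord0 i + l).
  rewrite (_ : (fun k => _) =
    (fun k => u 0%N ord0 i + series (telescope (fun k => u k ord0 i)) k)).
    by apply: cvgD => //; exact: cvg_cst.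
  by apply/funext => k; exact: eq_sum_telescope (fun k => u k ord0 i) k.
exists (\row_i limn (fun k => u k ord0 i)).
by apply: cvg_rV => i; rewrite mxE; exact: cu.
Qed.

(** * Subgradients, conjugates and proximal points *)

Section ConvexAnalysis.
Context {K : realType} {n : nat}.
Variable R : 'rV[K]_n -> \bar K.
Hypothesis R_proper : Defs.proper R.
Implicit Types x y p q : 'rV[K]_n.

Lemma subdiff_fin_num x q : subdiff R x q -> R x \is a fin_num.
Proof.
move=> xq; have [Rgt [y Ry]] := R_proper.
rewrite fin_numE gt_eqF ?Rgt //=; apply/eqP => Rx.
by have := lt_le_trans Ry (leey _); have := xq y; rewrite Rx /= leye_eq => /eqP ->.
Qed.

Lemma subdiff_fine x y q : subdiff R x q -> R y \is a fin_num ->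
  fine (R x) + dotp q (y - x) <= fine (R y).
Proof.
move=> xq Ry; have := xq y.
by rewrite -(fineK Ry) -(fineK (subdiff_fin_num xq)) -EFinD lee_fin.
Qed.

Lemma conjugate_ge x q : R x \is a fin_num ->
  ((dotp x q - fine (R x))%:E <= conjugate R q)%E.
Proof.
by move=> Rx; apply: ereal_sup_ubound; exists x => //; rewrite -{1}(fineK Rx) EFinB.
Qed.

(** Equality case of Fenchel-Young: the subgradient inequality says that [x] attains the
    supremum. *)
Lemma conjugate_subdiff x q : subdiff R x q ->
  conjugate R q = (dotp x q - fine (R x))%:E.
Proof.
move=> xq; have Rx := subdiff_fin_num xq; apply/le_anti.
rewrite conjugate_ge // andbT; apply: ge_ereal_sup => _ [y _ <-].
have := xq y; have [Rgt _] := R_proper; have := Rgt y.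
case: (R y) => [r||] // _; last by rewrite leNye.
rewrite -{1}(fineK Rx) -EFinD -EFinB !lee_fin dotpDr dotpNr (dotpC q y) (dotpC q x).
lra.
Qed.

Lemma subdiff_conjugate x q : subdiff R x q -> subdiff (conjugate R) q x.
Proof.
move=> xq p; rewrite (conjugate_subdiff xq) -EFinD.
apply: le_trans (conjugate_ge p (subdiff_fin_num xq)).
by rewrite lee_fin dotpDr dotpNr; lra.
Qed.

Lemma resolvent_subdiff (tau : K) (f v : 'rV[K]_n) : convex_efun R -> 0 < tau ->
  resolvent R tau f v -> subdiff R v (tau^-1 *: (f - v)).
Proof.
move=> cR tau0 vmin; have [Rgt [z Rz]] := R_proper.
have Rv : R v \is a fin_num.
  rewrite fin_numE gt_eqF ?Rgt //=; apply/eqP => Rv.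
  have := vmin z; rewrite Rv gt0_muley ?lte_fin // addey // leye_eq.
  have := Rgt z; move: Rz; case: (R z) => [r||] // _ _.
move=> y; have := Rgt y; case Ry: (R y) => [r||] // _; last by rewrite leey.
rewrite -(fineK Rv) -EFinD lee_fin; set s := fine (R v).
(* Comparing v with t y + (1 - t) v and dividing by t gives 0 <= A + t B;
   then let t tend to 0. *)
pose A := dotp (v - f) (y - v) + tau * (r - s).
pose B := 2^-1 * dotp (y - v) (y - v).
have AB (t : K) : 0 < t -> t <= 1 -> 0 <= A + t * B.
  move=> t0 t1; have := vmin (t *: y + (1 - t) *: v).
  have := cR y v t; rewrite (ltW t0) t1 => /(_ isT).
  rewrite Ry -(fineK Rv) -/s -!EFinM -!EFinD => Rt vt.
  have : (((2^-1 * enorm (v - f) ^+ 2)%R)%:E + (tau * s)%:E <=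
    (2^-1 * enorm (t *: y + (1 - t) *: v - f) ^+ 2)%:E +
    tau%:E * (t * r + (1 - t) * s)%:E)%E.
    by apply: (le_trans vt); rewrite leeD2l // lee_pmul2l // lte_fin.
  rewrite -EFinM -!EFinD lee_fin.
  have -> : t *: y + (1 - t) *: v - f = (v - f) + t *: (y - v).
    by rewrite scalerBl scale1r scalerBr; apply/rowP => i; rewrite !mxE; ring.
  rewrite !sqr_enorm (dotpDl (v - f)) !(dotpDr _ (v - f)) !dotpZl !dotpZr.
  rewrite (dotpC (y - v) (v - f)) => h.
  rewrite -(pmulr_rge0 _ t0) /A /B; lra.
have A0 : 0 <= A.
  rewrite leNgt; apply/negP => A0.
  have B0 : 0 < B by have := AB 1 ltr01 (lexx _); lra.
  have B2 : 0 < 2 * B by lra.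
  (* An explicit small [t] replaces the limit: [A + t * B] becomes [A / 2], which is negative. *)
  have t0 : 0 < - A / (2 * B) by rewrite divr_gt0 // oppr_gt0.
  have t1 : - A / (2 * B) <= 1.
    by rewrite ler_pdivrMr // mul1r; have := AB 1 ltr01 (lexx _); lra.
  have := AB _ t0 t1.
  by rewrite (_ : A + _ = A / 2); [lra | field; lra].
rewrite dotpZl -lerBrDl ler_pdivrMl // -(opprB v f) dotpNl.
by move: A0; rewrite /A; lra.
Qed.

(** The subgradient inequality at [z] bounds [R (x k)] above by a convergent sequence; lower
    semicontinuity passes the bound on to [R a]. *)
Lemma subdiff_closed (x y : nat -> 'rV[K]_n) (a b : 'rV[K]_n) :
  lower_semicontinuous R -> (forall k, subdiff R (x k) (y k)) ->
  x k @[k --> \oo] --> a -> y k @[k --> \oo] --> b -> subdiff R a b.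
Proof.
move=> lsc xy xa yb z; have [Rgt _] := R_proper.
have := Rgt z; case Rz: (R z) => [r||] // _; last by rewrite leey.
have cxy : r - dotp (y k) (z - x k) @[k --> \oo] --> r - dotp b (z - a).
  by apply: cvgB; [exact: cvg_cst|apply: cvg_dotp => //;
    apply: cvgB => //; exact: cvg_cst].
suff Ra : (R a <= (r - dotp b (z - a))%:E)%E.
  apply: (le_trans (leeD2r _ Ra)).
  by rewrite -EFinD lee_fin subrK.
rewrite leNgt; apply/negP => lt_Ra.
(* A real [c] strictly between the limit bound and [R a], which may be [+oo]. *)
have [c rc cR] : exists2 c, r - dotp b (z - a) < c & (c%:E < R a)%E.
  move: lt_Ra; case: (R a) => [s||] //.
    rewrite lte_fin => rs; exists ((r - dotp b (z - a) + s) / 2); first lra.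
    by rewrite lte_fin; lra.
  by move=> _; exists (r - dotp b (z - a) + 1); rewrite ?ltry // ltrDl.
have [V aV VR] := lsc _ _ cR.
near \oo => k.
have /VR cRx : V (x k) by near: k; exact: xa.
have : r - dotp (y k) (z - x k) < c by near: k; exact: cvgr_lt cxy _ rc.
have Rx := subdiff_fin_num (xy k).
have := subdiff_fine (xy k) (y := z); rewrite Rz => /(_ isT) /=.
by move: cRx; rewrite -(fineK Rx) lte_fin; lra.
Unshelve. all: by end_near. Qed.

End ConvexAnalysis.

(** * Finite length from the Kurdyka-Łojasiewicz inequality *)

Section KLFiniteLength.
Context {K : realType} {N : nat}.
Variables (J : 'rV[K]_N -> \bar K) (dJ : 'rV[K]_N -> set 'rV[K]_N).
Variables (w : nat -> 'rV[K]_N) (A : set 'rV[K]_N) (a d : nat -> K) (c rho Jlim : K).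
Hypothesis KLJ : KL_function J dJ.
Hypotheses (A_compact : compact A) (wA : forall k, A (w k)).
Hypothesis J_w : forall k, J (w k) = (Jlim + a k)%:E.
Hypotheses (a_ge0 : forall k, 0 <= a k) (a_cvg : a k @[k --> \oo] --> (0 : K)).
Hypotheses (d_ge0 : forall k, 0 <= d k) (c_ge0 : 0 <= c) (rho_gt0 : 0 < rho).
Hypothesis decrease : forall k, a k.+1 + rho * d k.+1 ^+ 2 <= a k.
Hypothesis edist_le : forall k, (Defs.edist 0%R (dJ (w k)) <= (c * d k)%:E)%E.
Hypothesis limit_points : forall (s : nat -> nat) w0,
  s @ \oo --> \oo -> w (s j) @[j --> \oo] --> w0 ->
  J w0 = Jlim%:E /\ dJ w0 !=set0.

(* [V] admits a desingularising function for the tail of [w], in integrated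
   form; unlike the form with derivatives it is stable under finite unions. *)
Definition desingularised (V : set 'rV[K]_N) : Prop :=
  exists (eta : K) (Phi : K -> K),
    [/\ 0 < eta, forall s, 0 <= s -> s < eta -> 0 <= Phi s,
        forall s t, 0 <= s -> s <= t -> t < eta -> Phi s <= Phi t &
        \forall k \near \oo, V (w k) -> 0 < a k -> a k < eta ->
          forall b, 0 <= b -> b <= a k -> a k - b <= c * d k * (Phi (a k) - Phi b)].

(** The sum of both functions serves the union: the extra summand is monotone, so it only enlarges
    the right-hand side. *)
Lemma desingularisedU U V :
  desingularised U -> desingularised V -> desingularised (U `|` V).
Proof.
move=> [e1 [f1 [e10 f1_ge0 f1_homo near1]]] [e2 [f2 [e20 f2_ge0 f2_homo near2]]].
exists (Num.min e1 e2), (fun s => f1 s + f2 s); split.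
- by rewrite lt_min e10.
- by move=> s s0; rewrite lt_min => /andP[? ?]; rewrite addr_ge0 ?f1_ge0 ?f2_ge0.
- by move=> s t s0 st; rewrite lt_min => /andP[? ?]; rewrite lerD ?f1_homo ?f2_homo.
have cd k : 0 <= c * d k by rewrite mulr_ge0.
near=> k => UV ak0; rewrite lt_min => /andP[ae1 ae2] b b0 bak.
have f1k := f1_homo _ _ b0 bak ae1; have f2k := f2_homo _ _ b0 bak ae2.
have [Uk|Vk] := UV.
  have h : a k - b <= c * d k * (f1 (a k) - f1 b).
    by move: b b0 bak {f1k f2k}; move: Uk ak0 ae1; near: k; exact: near1.
  by apply: (le_trans h); rewrite ler_wpM2l //; lra.
have h : a k - b <= c * d k * (f2 (a k) - f2 b).
  by move: b b0 bak {f1k f2k}; move: Vk ak0 ae2; near: k; exact: near2.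
by apply: (le_trans h); rewrite ler_wpM2l //; lra.
Unshelve. all: by end_near. Qed.

(** Multiply the tangent inequality for [phi] by [c * d k] and use that
    [derive1 phi (a k) * (c * d k)] is at least 1. *)
Lemma desingularised_KL w0 : J w0 = Jlim%:E -> dJ w0 !=set0 ->
  exists2 V, nbhs w0 V & desingularised V.
Proof.
move=> Jw0 /KLJ[eta [V [phi [eta0 w0V D KLV]]]]; exists V => //.
(* [eta] may be [+oo], whereas [desingularised] asks for a real threshold. *)
have [e e0 e_le] : exists2 e : K, 0 < e & (e%:E <= eta)%E.
  move: eta0 {D KLV}; case: eta => [e||] //; first by rewrite lte_fin; exists e.
  by move=> _; exists 1 => //; rewrite leey.
have e_lt s : s < e -> (s%:E < eta)%E by move=> se; apply: lt_le_trans e_le.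
exists e, phi; split => //.
- by move=> s s0 se; apply: (desing_ge0 D) => //; exact: e_lt.
- move=> s t s0 st te; have [t0|t_neq0] := eqVneq t 0.
    by rewrite (@le_anti _ _ s t) // st t0 s0.
  have t0 : 0 < t by rewrite lt0r t_neq0 (le_trans s0).
  have := concave_tangent D s0 st t0 (e_lt _ te).
  have := desing_derive_gt0 D t0 (e_lt _ te); nra.
near=> k => Vk ak0 ake b b0 bak.
have phi'_gt0 := desing_derive_gt0 D ak0 (e_lt _ ake).
have phi'_dist : 1 <= derive1 phi (a k) * (c * d k).
  have := KLV (w k) Vk; rewrite Jw0 J_w !lte_fin ltrDl => /(_ ak0).
  have -> : ((Jlim + a k)%:E < Jlim%:E + eta)%E.
    by apply: (@lt_le_trans _ _ (Jlim + e)%:E); rewrite ?lte_fin ?ltrD2l // EFinD leeD2l.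
  move=> /(_ isT); rewrite -EFinB /= addrC addKr => h.
  rewrite -lee_fin; apply: (le_trans h); rewrite EFinM.
  by apply: lee_wpmul2l; rewrite ?lee_fin ?(ltW phi'_gt0).
have := concave_tangent D b0 bak ak0 (e_lt _ ake).
move=> /(ler_wpM2l (mulr_ge0 c_ge0 (d_ge0 k))) /(le_trans _); apply.
rewrite mulrA [c * d k * _]mulrC ler_peMl // subr_ge0.
Unshelve. all: by end_near. Qed.

(** A point with a neighbourhood that [w] eventually avoids satisfies the property vacuously; any
    other point is a subsequential limit, where [limit_points] makes the KL property available. *)
Lemma desingularised_compact : desingularised A.
Proof.
apply: compact_induction => //.
- by exists 1, (fun=> 0); split => //; near=> k.
- move=> U V UV [e [f [e0 f0 fh near_f]]]; exists e, f; split => //.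
  by apply: filterS near_f => k h /UV.
- exact: desingularisedU.
move=> w0 _; have [[V w0V nV]|nV] :=
  pselect (exists2 V, nbhs w0 V & \forall k \near \oo, ~ V (w k)).
  exists V => //; exists 1, (fun=> 0); split => //.
  by apply: filterS nV.
(* The condition [j <= k] makes the chosen indices tend to infinity; they need not increase. *)
have ex_s (j : nat) : exists k, (j <= k)%N /\ ball w0 j.+1%:R^-1 (w k).
  apply: contrapT => nk; apply: nV; exists (ball w0 j.+1%:R^-1).
    by apply: nbhsx_ballx; rewrite invr_gt0.
  by near=> k => kb; apply: nk; exists k; split => //; near: k; exact: nbhs_infty_ge.
have [s sP] := choice ex_s.
have [Jw0 dJw0] : J w0 = Jlim%:E /\ dJ w0 !=set0; last exact: desingularised_KL.
apply: (limit_points (s := s)).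
  apply/cvgnyPge => M; near=> j; rewrite (leq_trans _ (sP j).1) //.
  by near: j; exact: nbhs_infty_ge.
apply/cvg_ballP => e e0; near=> j.
apply: le_ball (sP j).2; apply/ltW.
by near: j; exact: (near_infty_natSinv_lt (PosNum e0)).
Unshelve. all: by end_near. Qed.

(** With [b = a k.+1], the decrease and the integrated KL inequality bound [rho * d k.+1 ^+ 2] by
    [c * d k] times a difference of [Phi]. The arithmetic-geometric mean inequality turns this into
    a summable recursion and yields the 2 in [c / (2 * rho)]. *)
Theorem KL_finite_length : exists M, forall m, \sum_(0 <= k < m) d k <= M.
Proof.
have [e [Phi [e0 Phi0 Phi_homo near_Phi]]] := desingularised_compact.
have : \forall k \near \oo, a k < e /\ (0 < a k ->
    forall b, 0 <= b -> b <= a k -> a k - b <= c * d k * (Phi (a k) - Phi b)).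
  near=> k.
  have ake : a k < e by near: k; exact: cvgr_lt a_cvg _ e0.
  split => // ak0; move: ake; move: ak0; move: (wA k).
  by near: k; exact: near_Phi.
move=> [N0 _ HN0].
apply: (@summable_of_recursion _ d (Phi \o a) (c / (2 * rho)) N0) => //.
- by move=> k /HN0[? _]; exact: Phi0.
- by rewrite divr_ge0 // mulr_ge0 // ltW.
move=> k /HN0 [ake gain] /=.
have dec := decrease k; have ak1 := a_ge0 k.+1; have dk1 := d_ge0 k.+1.
have aS : a k.+1 <= a k by have := mulr_ge0 (ltW rho_gt0) (sqr_ge0 (d k.+1)); lra.
have rho0 : rho != 0 by rewrite gt_eqF.
set X := Phi (a k) - Phi (a k.+1).
have X0 : 0 <= X by rewrite subr_ge0 Phi_homo.
set Y := c / rho * X.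
have Y0 : 0 <= Y by rewrite mulr_ge0 // divr_ge0 // ltW.
have -> : c / (2 * rho) * X = Y / 2 by rewrite /Y; field.
have sq : d k.+1 ^+ 2 <= d k * Y.
  rewrite -(ler_pM2l rho_gt0).
  have -> : rho * (d k * Y) = c * d k * X by rewrite /Y; field.
  (* At [a k = 0] the KL inequality is silent, but the decrease already forces [d k.+1] to
     vanish. *)
  have [ak0|ak0] := eqVneq (a k) 0.
    have := mulr_ge0 (mulr_ge0 c_ge0 (d_ge0 k)) X0; lra.
  have := gain _ _ ak1 aS; rewrite lt0r ak0 a_ge0 => /(_ isT); rewrite -/X; lra.
have dk := d_ge0 k.
rewrite -ler_sqr ?nnegrE //; last by lra.
by apply: (le_trans sq); have := sqr_ge0 (d k - Y); nra.
Unshelve. all: by end_near. Qed.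

End KLFiniteLength.

(** The Cesàro means of the increments telescope to [(x k.+1 - x 0) / (k + 1)], which tends to 0 by
    boundedness, and they also tend to [l]. *)
Lemma bounded_increments_cvg (K : realType) (x : nat -> K) (C l : K) :
  (forall k, `|x k| <= C) -> x k.+1 - x k @[k --> \oo] --> l -> l = 0.
Proof.
move=> xC /cesaro meanl; apply: (cvg_unique _ meanl) => //.
have harm : 2 * C * harmonic k @[k --> \oo] --> (0 : K).
  by rewrite -(mulr0 (2 * C)); apply: cvgMr; exact: cvg_harmonic.
apply/norm_cvg0P; apply: (squeeze_cvgr _ (cvg_cst 0) harm); near=> k.
rewrite normr_ge0 /= /arithmetic_mean /= normrM [leLHS]mulrC.
have -> : series (fun k => x k.+1 - x k) k.+1 = x k.+1 - x 0%N.
  by rewrite [series _](telescopeK x).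
rewrite /harmonic [`|_^-1|]ger0_norm ?invr_ge0 // ler_wpM2r ?invr_ge0 //.
by rewrite (le_trans (ler_normB _ _)) //; have := xC k.+1; have := xC 0%N; lra.
Unshelve. all: by end_near. Qed.

(** * Estimates along the linearised Bregman iteration *)

Section LinearisedBregman.
Context {K : realType} {n : nat}.
Variables (L : K) (E : 'rV[K]_n -> K) (R : 'rV[K]_n -> \bar K).
Variables (rho1 : K) (tau : nat -> K) (u q : nat -> 'rV[K]_n).
Hypotheses (L_ge0 : 0 <= L) (EPsi : Psi L E).
Hypotheses (RGamma0 : Gamma0 R) (Rlb : locally_bounded_subgradients R).
Hypotheses (rho1_gt0 : 0 < rho1).
Hypothesis tau_bounds : forall k, 0 < tau k <= 2 / (L + 2 * rho1).
Hypothesis tau_inf : 0 < inf (range tau).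
Hypothesis iter : linearised_bregman E R tau u q.

Let R_proper := Gamma0_proper RGamma0.
Local Notation d k := (enorm (u k.+1 - u k)).
Local Notation G := (gradient E).

Lemma tau_gt0 k : 0 < tau k.
Proof. by have /andP[] := tau_bounds k. Qed.

Lemma tau_inv_le k : (tau k)^-1 <= (inf (range tau))^-1.
Proof.
rewrite lef_pV2 ?posrE ?tau_gt0 //; apply: ge_inf; last by exists k.
by exists 0 => _ [j _ <-]; rewrite ltW ?tau_gt0.
Qed.

(** The update of [q] is precisely the subgradient supplied by the optimality condition of the
    proximal step. *)
Lemma bregman_subdiff k : subdiff R (u k) (q k).
Proof.
case: k => [|k]; first exact: bregman_init iter.
rewrite (bregman_q iter) (_ : _ - _ = (tau k)^-1 *:
    (u k + tau k *: (q k - G (u k)) - u k.+1)).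
  apply: resolvent_subdiff; first exact: R_proper.
  - exact: Gamma0_convex RGamma0.
  - exact: tau_gt0.
  - exact: bregman_u iter k.
have /gt_eqF/negbT t0 := tau_gt0 k.
by apply/rowP => i; rewrite !mxE; field.
Qed.

Lemma bregman_fin_num k : R (u k) \is a fin_num.
Proof. exact: subdiff_fin_num (bregman_subdiff k). Qed.

Lemma bregman_incr k : q k.+1 - q k = - G (u k) - (tau k)^-1 *: (u k.+1 - u k).
Proof.
have /gt_eqF/negbT t0 := tau_gt0 k.
by rewrite (bregman_q iter); apply/rowP => i; rewrite !mxE; field.
Qed.

Lemma bregman_decrease k :
  E (u k.+1) + dotp (q k.+1 - q k) (u k.+1 - u k) + rho1 * d k ^+ 2 <= E (u k).
Proof.
have := descent (u k) (u k.+1) (Psi_differentiable EPsi) (Psi_lipschitz_gradient EPsi).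
rewrite bregman_incr dotpDl !dotpNl dotpZl -sqr_enorm.
(* The stepsize bound, inverted: [1 / tau k] beats the [L / 2] of the descent lemma with [rho1] to
   spare. *)
have : L / 2 + rho1 <= (tau k)^-1.
  have /andP[t0 tle] := tau_bounds k.
  rewrite -[leLHS]invrK lef_pV2 ?posrE ?invr_gt0 //; last first.
    by have := L_ge0; have := rho1_gt0; lra.
  apply: (le_trans tle); rewrite le_eqVlt; apply/orP; left; apply/eqP.
  by field; have := L_ge0; have := rho1_gt0; lra.
move=> /(ler_wpM2r (sqr_ge0 (d k))); lra.
Qed.

(** The bracket is the Bregman distance of [R] from [u k] to [u k.+1] with respect to [q k]. *)
Definition surrogate_value k :=
  E (u k.+1) + (fine (R (u k.+1)) - fine (R (u k)) - dotp (q k) (u k.+1 - u k)).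

Lemma surrogate_bregman k :
  surrogate E R (row_mx (u k.+1) (q k)) = (surrogate_value k)%:E.
Proof.
rewrite /surrogate row_mxKl row_mxKr (conjugate_subdiff R_proper (bregman_subdiff k)).
rewrite -(fineK (bregman_fin_num k.+1)) -!EFinD /surrogate_value /=; congr (_%:E).
by rewrite dotpDr dotpNr (dotpC (q k) (u k.+1)) (dotpC (q k) (u k)); lra.
Qed.

Lemma surrogate_value_ge k : E (u k.+1) <= surrogate_value k.
Proof.
have := subdiff_fine R_proper (bregman_subdiff k) (bregman_fin_num k.+1).
rewrite /surrogate_value; lra.
Qed.

(** The inner product in [bregman_decrease] is the sum of the Bregman distances in both directions;
    the one from [u k.+1] to [u k] is nonnegative and is dropped. *)
Lemma surrogate_value_le k : surrogate_value k + rho1 * d k ^+ 2 <= E (u k).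
Proof.
have := subdiff_fine R_proper (bregman_subdiff k.+1) (bregman_fin_num k).
have := bregman_decrease k.
rewrite /surrogate_value dotpDl dotpNl -(opprB (u k.+1) (u k)) dotpNr; lra.
Qed.

Lemma E_bregman_cvg : exists2 l, E (u k) @[k --> \oo] --> l & forall k, l <= E (u k).
Proof.
have noninc : nonincreasing_seq (E \o u).
  apply/nonincreasing_seqP => k /=; have := surrogate_value_ge k.
  have := surrogate_value_le k; have := mulr_ge0 (ltW rho1_gt0) (sqr_ge0 (d k)); lra.
have [m Em] := Psi_bounded_below EPsi.
have Ecvg : cvgn (E \o u).
  by apply: nonincreasing_is_cvgn => //; exists m => _ [k _ <-]; exact: Em.
by exists (limn (E \o u)) => // k; exact: nonincreasing_cvgn_ge.
Qed.

Lemma increment_cvg0 : u k.+1 - u k @[k --> \oo] --> (0 : 'rV[K]_n).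
Proof.
have [l El _] := E_bregman_cvg.
have sq0 : rho1^-1 * (E (u k) - E (u k.+1)) @[k --> \oo] --> (0 : K).
  rewrite -(mulr0 rho1^-1) -(subrr l); apply: cvgMr; apply: cvgB => //.
  by rewrite (cvg_shiftS (E \o u)).
apply/cvgrPdist_le => e e0; near=> k.
rewrite sub0r normrN (le_trans (normr_le_enorm _)) //.
rewrite -ler_sqr ?nnegrE ?enorm_ge0 ?(ltW e0) //.
have h : rho1^-1 * (E (u k) - E (u k.+1)) <= e ^+ 2.
  by near: k; apply: cvgr_le sq0 _ _; rewrite exprn_gt0.
apply: le_trans h; rewrite ler_pdivlMl //.
have := surrogate_value_ge k; have := surrogate_value_le k; lra.
Unshelve. all: by end_near. Qed.

Lemma bregman_bounded : exists M : K, forall k i,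
  `|u k ord0 i| <= M /\ `|q k ord0 i| <= M.
Proof.
have [M0 [_ HM]] := Psi_bounded_level_sets EPsi (E (u 0%N)).
(* [bounded_set] only provides bounds strictly above [M0]. *)
pose M := M0 + 1.
have coord_le (x : 'rV[K]_n) i : `|x ord0 i| <= `|x|.
  rewrite [leRHS]/Num.norm /= mx_normrE.
  exact: (le_bigmax _ (fun ij => `|x ij.1 ij.2|) (ord0, i)).
have uM k i : `|u k ord0 i| <= M.
  apply: (le_trans (coord_le _ _)); apply: HM; first by rewrite ltrDl.
  elim: k => //= k IH; apply: le_trans IH.
  have := surrogate_value_ge k; have := surrogate_value_le k.
  have := mulr_ge0 (ltW rho1_gt0) (sqr_ge0 (d k)); lra.
(* All iterates lie in the compact cube of half-width [M], so their subgradients are uniformly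
   bounded. *)
have [C [_ HC]] := Rlb (@rV_compact K n (fun=> `[- M, M]%classic)
  (fun=> @segment_compact _ _ _)).
exists (Num.max M C) => k i; rewrite !le_max uM; split => //.
apply/orP; right; apply: (le_trans (enorm_coord _ _)).
apply: (HC (u k) (q k) _ (bregman_subdiff k)).
by move=> j /=; rewrite in_itv /= -ler_norml uM.
Qed.

(** Take [q k.+1] as subgradient at [u k.+1] and [u k] as subgradient of the conjugate at [q k]. By
    [bregman_incr] the first block is a gradient difference minus a scaled step, which gives [L] and
    the inverse infimum; the second block gives the 1. *)
Lemma surrogate_subdiff_le k :
  (Defs.edist 0%R (surrogate_subdiff E R (row_mx (u k.+1) (q k))) <=
   ((L + (inf (range tau))^-1 + 1) * d k)%:E)%E.
Proof.
set v := row_mx (G (u k.+1) + q k.+1 - q k) (u k - u k.+1).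
apply: (@le_trans _ _ (enorm (v - 0))%:E).
  apply: ereal_inf_lbound; exists v => //; rewrite /surrogate_subdiff /= row_mxKl row_mxKr.
  exists (q k.+1); first exact: bregman_subdiff.
  by exists (u k) => //; apply: subdiff_conjugate => //; exact: bregman_subdiff.
rewrite lee_fin subr0 (le_trans (enorm_row_mx _ _)) // mulrDl mul1r.
rewrite -(opprB (u k.+1)) enormN lerD2r -addrA bregman_incr addrA mulrDl.
rewrite (le_trans (enormB _ _)) // lerD ?(Psi_lipschitz_gradient EPsi) //.
rewrite enormZ ler_wpM2r ?enorm_ge0 // ger0_norm ?invr_ge0 ?(ltW (tau_gt0 _)) //.
exact: tau_inv_le.
Qed.

Hypothesis KLF : KL_function (surrogate E R) (surrogate_subdiff E R).

Theorem bregman_finite_length :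
  exists M, forall m, \sum_(0 <= k < m) d k <= M.
Proof.
have [l El l_le] := E_bregman_cvg; have [M bM] := bregman_bounded.
pose w k := row_mx (u k.+1) (q k).
pose A := [set v : 'rV[K]_(n + n) | forall i, `[- M, M]%classic (v ord0 i)].
apply: (@KL_finite_length _ _ (surrogate E R) (surrogate_subdiff E R) w A
  (fun k => surrogate_value k - l) _ (L + (inf (range tau))^-1 + 1) rho1 l) => //.
- exact: (@rV_compact K (n + n) (fun=> `[- M, M]%classic) (fun=> @segment_compact _ _ _)).
- move=> k i /=; rewrite in_itv /= -ler_norml /w mxE.
  by case: (fintype.split i) => j; have [uk qk] := bM k j; have [] := bM k.+1 j.
- by move=> k; rewrite surrogate_bregman addrC subrK.
- by move=> k; rewrite subr_ge0 (le_trans (l_le k.+1)) // surrogate_value_ge.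
(* The surrogate values are squeezed between [E (u k.+1)] and [E (u k)]. *)
- rewrite -(subrr l); apply: cvgB; last exact: cvg_cst.
  apply: (squeeze_cvgr (f := fun k => E (u k.+1)) (h := fun k => E (u k))) => //.
    near=> k; rewrite surrogate_value_ge /=.
    have := surrogate_value_le k; have := mulr_ge0 (ltW rho1_gt0) (sqr_ge0 (d k)); lra.
  by rewrite (cvg_shiftS (E \o u)).
- by move=> k; exact: enorm_ge0.
- by rewrite !addr_ge0 ?invr_ge0 ?(ltW tau_inf).
(* [E (u k.+1)] separates consecutive surrogate values, so the drop is controlled by the later step
   [d k.+1]. *)
- move=> k; have := surrogate_value_ge k; have := surrogate_value_le k.+1; lra.
- exact: surrogate_subdiff_le.
move=> s w0 s_oo ws.
have us : u (s j).+1 @[j --> \oo] --> lsubmx w0.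
  have := cvg_comp _ _ ws (@continuous_lsubmx _ 1 n n w0).
  by rewrite (_ : _ \o _ = fun j => u (s j).+1) //; apply/funext => j; exact: row_mxKl.
have qs : q (s j) @[j --> \oo] --> rsubmx w0.
  have := cvg_comp _ _ ws (@continuous_rsubmx _ 1 n n w0).
  by rewrite (_ : _ \o _ = q \o s) //; apply/funext => j; exact: row_mxKr.
(* Vanishing increments give [u (s j)] the same limit as [u (s j).+1]; it is [u (s j)] that is
   paired with [q (s j)] as subgradient. *)
have us' : u (s j) @[j --> \oo] --> lsubmx w0.
  rewrite (_ : (fun j => u (s j)) = (fun j => u (s j).+1 - (u (s j).+1 - u (s j)))).
    rewrite -(subr0 (lsubmx w0)); apply: cvgB => //.
    exact: (cvg_comp _ _ s_oo increment_cvg0).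
  by apply/funext => j; rewrite opprB addrC subrK.
have w0_sub : subdiff R (lsubmx w0) (rsubmx w0).
  apply: subdiff_closed us' qs => //; first exact: Gamma0_lsc RGamma0.
  by move=> j; exact: bregman_subdiff.
have El' : E (lsubmx w0) = l.
  have Es : E (u (s j)) @[j --> \oo] --> E (lsubmx w0).
    apply: (cvg_comp _ _ us').
    exact: differentiable_continuous (Psi_differentiable EPsi _).
  exact: (cvg_unique _ Es (cvg_comp _ _ s_oo El)).
(* Fenchel equality at the limit pair cancels all of the surrogate except [E], whose value there is
   [l]. *)
split.
  rewrite /surrogate (conjugate_subdiff R_proper w0_sub) El'.
  rewrite -(fineK (subdiff_fin_num R_proper w0_sub)) -!EFinD; congr (_%:E) => /=.
  by lra.
exists (row_mx (G (lsubmx w0) + rsubmx w0 - rsubmx w0) (lsubmx w0 - lsubmx w0)).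
exists (rsubmx w0) => //; exists (lsubmx w0) => //.
exact: subdiff_conjugate.
Unshelve. all: by end_near. Qed.

End LinearisedBregman.

Theorem corollary4p10 (K : realType) (n : nat) (L : K)
    (E : 'rV[K]_n -> K) (R : 'rV[K]_n -> \bar K)
    (rho1 : K) (tau : nat -> K) (u q : nat -> 'rV[K]_n)
    (L_ge0 : 0 <= L) (EPsi : Psi L E)
    (RGamma0 : Gamma0 R) (Rlb : locally_bounded_subgradients R)
    (KLF : KL_function (surrogate E R) (surrogate_subdiff E R))
    (rho1_gt0 : 0 < rho1)
    (tau_bounds : forall k, 0 < tau k <= 2 / (L + 2 * rho1))
    (tau_inf : 0 < inf (range tau))
    (iter : linearised_bregman E R tau u q) :
  exists ubar : 'rV[K]_n,
    u k @[k --> \oo] --> ubar /\ gradient E ubar = 0.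
Proof.
have [M uM] := bregman_finite_length L_ge0 EPsi RGamma0 Rlb rho1_gt0 tau_bounds
  tau_inf iter KLF.
have [ubar u_cvg] := cvg_finite_length uM.
exists ubar; split => //; apply/rowP => i.
rewrite [RHS]mxE; apply: oppr_inj; rewrite oppr0.
have [C uqC] := bregman_bounded L_ge0 EPsi RGamma0 Rlb rho1_gt0 tau_bounds iter.
(* Each coordinate of [q] is bounded, so it suffices that its increments tend to that of
   [- gradient E ubar]. *)
apply: (bounded_increments_cvg (x := fun k => q k ord0 i) (C := C)).
  by move=> k; have [] := uqC k i.
have incr0 := increment_cvg0 L_ge0 EPsi RGamma0 rho1_gt0 tau_bounds iter.
have Gu : gradient E (u k) @[k --> \oo] --> gradient E ubar.
  apply: (cvg_comp _ _ u_cvg); exact: Psi_continuous_gradient EPsi _.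
(* The positive infimum of the stepsizes keeps their inverses bounded, so the scaled steps vanish
   too. *)
have step0 : (tau k)^-1 * (u k.+1 - u k) ord0 i @[k --> \oo] --> (0 : K).
  have bound0 : (inf (range tau))^-1 * `|(u k.+1 - u k) ord0 i| @[k --> \oo] --> (0 : K).
    rewrite -(mulr0 (inf (range tau))^-1); apply: cvgMr; apply/norm_cvg0P.
    by have := cvg_coord (i := i) incr0; rewrite mxE; apply.
  apply/norm_cvg0P; apply: (squeeze_cvgr _ (cvg_cst 0) bound0); near=> k.
  rewrite normr_ge0 /= normrM ler_wpM2r //.
  rewrite ger0_norm ?invr_ge0 ?(ltW (tau_gt0 tau_bounds _)) //.
  exact: tau_inv_le tau_bounds tau_inf _.
rewrite (_ : (fun k => q k.+1 ord0 i - q k ord0 i) =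
  (fun k => - gradient E (u k) ord0 i - (tau k)^-1 * (u k.+1 - u k) ord0 i)).
  rewrite -[X in _ --> X]subr0; apply: cvgB => //.
  by apply: cvgN; exact: cvg_coord.
apply/funext => k; have := bregman_incr tau_bounds iter k.
by move=> /rowP/(_ i); rewrite !mxE.
Unshelve. all: by end_near. Qed.
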